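(* Every central reduced ring is abelian.
   Context: All rings are associative with identity, not necessarily commutative. A ring is called central reduced if every nilpotent element of it is central. A ring is called abelian if every idempotent in it is central. *)

(* Defs.v *)
From mathcomp Require Import all_boot all_algebra.

Set Implicit Arguments.
Unset Strict Implicit.
Unset Printing Implicit Defensive.

Import GRing.Theory.
Local Open Scope ring_scope.

(* Rings are [pzRingType]: associative, unital, not necessarily commutative,
   with the zero ring allowed. *)

Definition central (R : pzRingType) (x : R) : Prop :=
  forall y : R, GRing.comm x y.

Definition nilpotent_elt (R : pzRingType) (x : R) : Prop :=
  exists2 n : nat, (0 < n)%N & x ^+ n = 0.

Definition idempotent_elt (R : pzRingType) (x : R) : Prop := x * x = x.

Definition central_reduced (R : pzRingType) : Prop :=
  forall x : R, nilpotent_elt x -> central x.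

Definition abelian_ring (R : pzRingType) : Prop :=
  forall e : R, idempotent_elt e -> central e.

(* Main.v *)
(* For an idempotent e and any y, the Peirce components ey(1-e) and (1-e)ye
   square to zero, hence are central. An element x with ex = x and xe = 0 that
   commutes with e vanishes, so ey = eye = ye. *)
Require Import Defs.
From mathcomp Require Import all_boot all_algebra.

Import GRing.Theory.
Local Open Scope ring_scope.

Lemma central_reduced_sqr0 (R : pzRingType) (x : R) :
  central_reduced R -> x * x = 0 -> central x.
Proof. by move=> redR xx0; apply: redR; exists 2; rewrite ?expr2. Qed.

(** The square vanishes because [x * x = x * (e * x) = (x * e) * x]. *)
Lemma central_reduced_peirce_l (R : pzRingType) (e x : R) :
  central_reduced R -> e * x = x -> x * e = 0 -> x = 0.
Proof.
(* Expanding both sides of [x = 0] turns the goal into commutation of [x] with [e]. *)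
move=> redR ex xe; rewrite -ex -[RHS]xe; apply/esym.
by apply: central_reduced_sqr0 => //; rewrite -[in X in _ * X]ex mulrA xe mul0r.
Qed.

Lemma central_reduced_peirce_r (R : pzRingType) (e x : R) :
  central_reduced R -> e * x = 0 -> x * e = x -> x = 0.
Proof.
move=> redR ex xe; rewrite -xe -[RHS]ex.
(* Here [x * x = (x * e) * x = x * (e * x) = 0]. *)
by apply: central_reduced_sqr0 => //; rewrite -[in X in X * _]xe -mulrA ex mulr0.
Qed.

Theorem proposition2p17 (R : pzRingType) : central_reduced R -> abelian_ring R.
Proof.
move=> redR e ee y.
(* This is [e * y * (1 - e)], fixed by [e] on the left and killed on the right. *)
have /subr0_eq ey : e * y - e * y * e = 0.
  apply: (central_reduced_peirce_l _ e) => //.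
    by rewrite mulrBr !mulrA ee.
  by rewrite mulrBl -!mulrA ee subrr.
(* The mirror component [(1 - e) * y * e]. *)
have /subr0_eq ye : y * e - e * y * e = 0.
  apply: (central_reduced_peirce_r _ e) => //.
    by rewrite mulrBr !mulrA ee subrr.
  by rewrite mulrBl -!mulrA ee.
by rewrite /GRing.comm ey ye.
Qed.
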